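(* Let $m,n\geq k\geq1$ be integers, and let $A,B\in\mathbb{R}^{m\times n}$. Then the interval hull $\mathbb{I}(A,B)$ is totally non-positive of order $k$ if and only if the matrices $$\{I_{z,\tilde z}(A,B): z\in\{\pm1\}^m,\ \tilde z\in\{\pm1\}^n\}$$ are all totally non-positive of order $k$.
   Context: A real matrix is totally non-positive of order $k$ if all its minors of order at most $k$ are non-positive. The interval hull of $A,B\in\mathbb{R}^{m\times n}$ is $$\mathbb{I}(A,B)=\{C\in\mathbb{R}^{m\times n}: c_{ij}=t_{ij}a_{ij}+(1-t_{ij})b_{ij},\ t_{ij}\in[0,1]\},$$ and it is called totally non-positive of order $k$ if every matrix in it is totally non-positive of order $k$. For $z\in\{\pm1\}^m$, $\tilde z\in\{\pm1\}^n$, let $D_z$ be the diagonal matrix whose $i$th diagonal entry is $z_i$, let $|M|$ denote the entrywise absolute value of a matrix $M$, and set $$I_{z,\tilde z}(A,B):=\frac{A+B}{2}-D_z\frac{|A-B|}{2}D_{\tilde z}.$$ *)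

(* Defs.v *)
From mathcomp Require Import all_boot all_order all_algebra.
From mathcomp Require Import reals.

Set Implicit Arguments.
Unset Strict Implicit.
Unset Printing Implicit Defensive.

Import Order.TTheory GRing.Theory Num.Theory.
Local Open Scope ring_scope.

(* The bound 0 < r matters: the determinant of the empty matrix is 1, so
   minors start at order 1. Rows and columns are selected in increasing order,
   since reordering them could change the sign of the determinant. *)
Definition totally_nonpositive (R : realType) (m n k : nat)
    (A : 'M[R]_(m, n)) : Prop :=
  forall (r : nat) (f : 'I_r -> 'I_m) (g : 'I_r -> 'I_n),
    (0 < r <= k)%N ->
    {homo f : i j / (i < j)%N} -> {homo g : i j / (i < j)%N} ->
    \det (mxsub f g A) <= 0.

Definition interval_hull (R : realType) (m n : nat)
    (A B C : 'M[R]_(m, n)) : Prop :=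
  exists t : 'M[R]_(m, n),
    (forall i j, 0 <= t i j <= 1) /\
    (forall i j, C i j = t i j * A i j + (1 - t i j) * B i j).

Definition hull_totally_nonpositive (R : realType) (m n k : nat)
    (A B : 'M[R]_(m, n)) : Prop :=
  forall C : 'M[R]_(m, n), interval_hull A B C -> totally_nonpositive k C.

Definition sign_vector (R : realType) (m : nat) (z : 'rV[R]_m) : Prop :=
  forall i, z 0 i = 1 \/ z 0 i = -1.

Definition abs_mx (R : realType) (m n : nat) (M : 'M[R]_(m, n)) :
    'M[R]_(m, n) :=
  map_mx (fun x : R => `|x|) M.

Definition vertex_mx (R : realType) (m n : nat) (z : 'rV[R]_m) (w : 'rV[R]_n)
    (A B : 'M[R]_(m, n)) : 'M[R]_(m, n) :=
  2^-1 *: (A + B) - diag_mx z *m (2^-1 *: abs_mx (A - B)) *m diag_mx w.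

(* Main.v *)
Require Import Defs.
From mathcomp Require Import all_boot all_order all_algebra.
From mathcomp Require Import reals zify ring lra.

(** The vertex matrices lie in the interval hull, which gives one direction.
    The other is an induction on the order of the minor. The derivative of a
    determinant with respect to the entry (i, j) is the cofactor, that is
    (-1) ^ (i + j) times a minor of order one less. Once the minors of that
    smaller order, if it is positive, are known to be non-positive on the
    whole hull, the determinant of the chosen square submatrix is monotone in
    every entry, decreasing when i + j is even and increasing when i + j is
    odd. It is therefore maximal where the entries are alternately smallest
    and largest, in a checkerboard pattern ([det_le_checkerboard]). This
    extremal submatrix is cut out of a vertex matrix: the signs z and w only
    have to alternate along the selected rows and columns
    ([sign_vector_along]). The induction starts at order 1, where the largest
    value of a single entry is also attained at a vertex matrix. *)

Set Implicit Arguments.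
Unset Strict Implicit.
Unset Printing Implicit Defensive.

Import Order.TTheory GRing.Theory Num.Theory.
Local Open Scope ring_scope.

Lemma homo_ltn_ord_inj (r m : nat) (f : 'I_r -> 'I_m) :
  {homo f : i j / (i < j)%N} -> injective f.
Proof.
move=> hf i j fij; apply/val_inj; case: (ltngtP i j) => // /hf.
  by rewrite fij ltnn.
by rewrite fij ltnn.
Qed.

Section Hull.
Variable R : realType.

Section Membership.
Variables (m n : nat).
Implicit Types (A B C : 'M[R]_(m, n)) (z : 'rV[R]_m) (w : 'rV[R]_n).

Lemma vertex_mxE z w A B i j :
  vertex_mx z w A B i j =
  2^-1 * (A i j + B i j) - z 0 i * w 0 j * (2^-1 * `|A i j - B i j|).
Proof. by rewrite /vertex_mx mul_diag_mx mul_mx_diag !mxE mulrAC. Qed.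

Lemma interval_hull_dist A B C :
  interval_hull A B C -> forall i j,
  `|C i j - 2^-1 * (A i j + B i j)| <= 2^-1 * `|A i j - B i j|.
Proof.
move=> [t [t01 CE]] i j; have /andP[t0 t1] := t01 i j.
have -> : C i j - 2^-1 * (A i j + B i j) = (t i j - 2^-1) * (A i j - B i j).
  by rewrite CE; field.
rewrite normrM ler_wpM2r // ler_norml; apply/andP; split; lra.
Qed.

Lemma vertex_mx_in_hull z w A B :
  sign_vector z -> sign_vector w -> interval_hull A B (vertex_mx z w A B).
Proof.
move=> hz hw.
(* With s = 1 when A i j >= B i j and s = -1 otherwise, |a - b| = s (a - b),
   and (a + b) / 2 - z w s (a - b) / 2 has weight (1 - z w s) / 2 on a. *)
exists (\matrix_(i, j)
  (2^-1 * (1 - z 0 i * w 0 j * (if B i j <= A i j then 1 else -1)))).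
split=> i j; rewrite ?vertex_mxE !mxE.
  case: (hz i) => ->; case: (hw j) => ->; case: ifP => _;
  by apply/andP; split; lra.
by case: lerP => _; field.
Qed.

(** A vertex matrix is extremal in the hull, entry (i, j) being pushed as far
    as possible in the direction opposite to z i * w j. *)
Lemma vertex_mx_extremal z w A B C i j :
  sign_vector z -> sign_vector w -> interval_hull A B C ->
  z 0 i * w 0 j * vertex_mx z w A B i j <= z 0 i * w 0 j * C i j.
Proof.
move=> hz hw /interval_hull_dist/(_ i j); rewrite vertex_mxE ler_norml.
by move=> /andP[lo hi]; case: (hz i) => ->; case: (hw j) => ->; lra.
Qed.

(** The row-wise hybrid of two matrices. It is used to move from one matrix to
    another one row at a time, the determinant being linear in each row. *)
Definition mix_rows (S : {pred 'I_m}) (V C : 'M[R]_(m, n)) : 'M[R]_(m, n) :=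
  \matrix_(i, j) if i \in S then V i j else C i j.

(** The hull is a product of intervals, hence stable under such hybrids. *)
Lemma interval_hull_mix_rows (S : {pred 'I_m}) A B C1 C2 :
  interval_hull A B C1 -> interval_hull A B C2 ->
  interval_hull A B (mix_rows S C1 C2).
Proof.
move=> [t [t01 tE]] [u [u01 uE]]; exists (mix_rows S t u).
by split=> i j; rewrite !mxE; case: ifP.
Qed.

End Membership.

Lemma mxsub_mix_rows (m n r s : nat) (f : 'I_r -> 'I_m) (g : 'I_s -> 'I_n)
    (S : {pred 'I_r}) (V C : 'M[R]_(m, n)) :
  injective f ->
  mxsub f g (mix_rows (mem [set f i | i in S]) V C) =
  mix_rows S (mxsub f g V) (mxsub f g C).
Proof.
move=> f_inj; apply/matrixP => i j.
by rewrite !mxE (mem_imset S i f_inj).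
Qed.

(** Replacing row i changes the determinant by the sum over j of the change of
    the entry (i, j) times its cofactor, and the cofactors of row i do not see
    the replacement. The sign condition makes each of these terms non-negative,
    so the determinant grows as the rows of C are replaced one by one. *)
Lemma det_le_checkerboard (n : nat) (C V : 'M[R]_n) :
  (forall i j : 'I_n, (-1) ^+ (i + j) * V i j <= (-1) ^+ (i + j) * C i j) ->
  (forall (S : {pred 'I_n}) i j,
     \det (row' i (col' j (mix_rows S V C))) <= 0) ->
  \det C <= \det V.
Proof.
move=> leVC minor_le0.
pose H p := mix_rows [pred i : 'I_n | (i < p)%N] V C.
have -> : C = H 0 by apply/matrixP => i j; rewrite mxE.
have -> : V = H n by apply/matrixP => i j; rewrite mxE inE ltn_ord.
suff : forall p, (p <= n)%N -> \det (H 0) <= \det (H p) by exact.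
elim=> [//|p IHp] lt_pn.
apply: le_trans (IHp (ltnW lt_pn)) _.
pose i := Ordinal lt_pn.
rewrite (expand_det_row (H p) i) (expand_det_row (H p.+1) i).
apply: ler_sum => j _.
have -> : cofactor (H p) i j = cofactor (H p.+1) i j.
  congr (_ * \det _); apply/matrixP => a b; rewrite !mxE !inE ltnS.
  rewrite [in RHS]leq_eqVlt -[p]/(val i) val_eqE eq_sym.
  by rewrite (negPf (neq_lift i a)).
rewrite !mxE !inE /= ltnn leqnn /cofactor mulrCA [leRHS]mulrCA !mulrA.
by apply: ler_wnM2r; [exact: minor_le0 | rewrite leVC].
Qed.

(** Signs may be prescribed freely along the image of an injection. *)
Lemma sign_vector_along (r m : nat) (f : 'I_r -> 'I_m) (e : 'I_r -> nat) :
  injective f ->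
  exists2 z : 'rV[R]_m, sign_vector z & forall i, z 0 (f i) = (-1) ^+ e i.
Proof.
move=> f_inj.
exists (\row_p if [pick i | f i == p] is Some i then (-1) ^+ e i else 1).
  move=> p; rewrite mxE; case: pickP => [i _|_]; last by left.
  by rewrite -signr_odd; case: odd; [right | left].
move=> i; rewrite mxE; case: pickP => [j /eqP/f_inj-> //|/(_ i)].
by rewrite eqxx.
Qed.

Lemma vertices_hull_totally_nonpositive (m n k : nat) (A B : 'M[R]_(m, n)) :
  (forall (z : 'rV[R]_m) (w : 'rV[R]_n), sign_vector z -> sign_vector w ->
     totally_nonpositive k (vertex_mx z w A B)) ->
  hull_totally_nonpositive k A B.
Proof.
move=> vertex_le0 C hC r; elim: r C hC => [//|r IHr] C hC f g rk hf hg.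
have f_inj := homo_ltn_ord_inj hf; have g_inj := homo_ltn_ord_inj hg.
case: r => [|r] in IHr f g rk hf hg f_inj g_inj *.
  (* At order 1, z = 1 and w = -1 give the largest value of every entry. *)
  have z1 : sign_vector (const_mx 1 : 'rV[R]_m) by left; rewrite mxE.
  have w1 : sign_vector (const_mx (-1) : 'rV[R]_n) by right; rewrite mxE.
  have := vertex_le0 _ _ z1 w1 _ f g rk hf hg.
  have := vertex_mx_extremal (f 0) (g 0) z1 w1 hC.
  rewrite !det_mx11 [mxsub _ _ _ _ _]mxE [mxsub _ _ C _ _]mxE.
  rewrite ![const_mx _ _ _]mxE; lra.
have [z hz zE] := sign_vector_along (fun i => i : nat) f_inj.
have [w hw wE] := sign_vector_along (fun i => i : nat) g_inj.
pose V := vertex_mx z w A B.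
apply: le_trans (vertex_le0 z w hz hw _ f g rk hf hg).
apply: det_le_checkerboard => [i j|S i j].
  rewrite ![mxsub _ _ _ _ _]mxE exprD -zE -wE.
  exact: vertex_mx_extremal.
rewrite -mxsub_mix_rows //.
rewrite [row' _ _](_ : _ = mxsub (f \o lift i) (g \o lift j)
  (mix_rows (mem [set f i | i in S]) V C)); last first.
  by apply/matrixP => a b; rewrite !mxE.
have lift_homo (h : 'I_r.+2) : {homo lift h : a b / (a < b)%N}.
  by move=> a b; rewrite /= /bump; lia.
apply: IHr.
- by apply: interval_hull_mix_rows => //; exact: vertex_mx_in_hull.
- by case/andP: rk => _ /ltnW.
- by move=> a b /(lift_homo i)/hf.
- by move=> a b /(lift_homo j)/hg.
Qed.

End Hull.

Theorem theorem5p5 (R : realType) (m n k : nat)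
    (k_ge1 : (1 <= k)%N) (k_le_m : (k <= m)%N) (k_le_n : (k <= n)%N)
    (A B : 'M[R]_(m, n)) :
  hull_totally_nonpositive k A B <->
  (forall (z : 'rV[R]_m) (w : 'rV[R]_n),
     sign_vector z -> sign_vector w ->
     totally_nonpositive k (vertex_mx z w A B)).
Proof.
split=> [hull_le0 z w hz hw|]; last exact: vertices_hull_totally_nonpositive.
exact/hull_le0/vertex_mx_in_hull.
Qed.
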